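(* Let $P=(P_{ij})_{i,j\in E}$ be an irreducible aperiodic transition matrix on a countable state space $E$ and let $H$ be a non-empty finite subset of $E$. Then the chain is non-ergodic if and only if there is a sequence $\{y^{(n)}\}_{n=1}^{\infty}$ of real-valued functions $y^{(n)}=(y^{(n)}_i)_{i\in E}$ on $E$ satisfying the following conditions: (1) for each $n\ge 1$, $\sup_{i\in E} y^{(n)}_i<\infty$ and $y=y^{(n)}$ solves the inequality $$y_i\le \sum_{j\notin H}P_{ij}\,y_j+1,\qquad i\in E;$$ (2) $\sup_{n\ge 1}\max_{i\in H} y^{(n)}_i=\infty$ (or equivalently, $\varlimsup_{n\to\infty}\max_{i\in H}y^{(n)}_i=\infty$).
   Context: $P$ is a stochastic matrix and $(X_n)_{n\ge0}$ the associated discrete-time Markov chain. The chain is ergodic if, with $\pi$ its stationary probability distribution, for each $i\in E$, $\sum_{j\in E}|(P^n)_{ij}-\pi_j|\to0$ as $n\to\infty$. Known equivalent description: with $\sigma_H=\inf\{n\ge1: X_n\in H\}$, the chain is ergodic iff $\max_{i\in H}\mathbf{E}_i\sigma_H<\infty$ for some (equivalently, any) non-empty finite $H\subseteq E$. The functions $y^{(n)}$ are finite-valued but need not be non-negative nor bounded below. *)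

(* Defs.v *)
From HB Require Import structures.
From mathcomp Require Import all_boot all_order all_algebra finmap.
From mathcomp Require Import all_classical all_reals all_analysis.

Set Implicit Arguments.
Unset Strict Implicit.
Unset Printing Implicit Defensive.

Import Order.TTheory GRing.Theory Num.Theory.

Local Open Scope classical_set_scope.
Local Open Scope ring_scope.
Local Open Scope ereal_scope.

(* [\esum] is only meaningful for non-negative terms.  This is the sum of a
   signed family, with values in the extended reals: the sum of the positive
   parts minus the sum of the negative parts.  It is well defined as soon as one
   of the two sums is finite; the junk value is [+oo - +oo = -oo]. *)
Definition signed_esum (R : realType) (E : choiceType) (D : set E)
    (f : E -> \bar R) : \bar R :=
  \esum_(j in D) f^\+ j - \esum_(j in D) f^\- j.

Definition prob_distribution (R : realType) (E : countType)
    (p : E -> R) : Prop :=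
  (forall i, (0 <= p i)%R) /\ \esum_(i in [set: E]) (p i)%:E = 1.

Definition transition_matrix (R : realType) (E : countType)
    (P : E -> E -> R) : Prop :=
  forall i, prob_distribution (P i).

(* Every sum below is in [0, 1] when [P] is a transition matrix, so that [fine]
   loses nothing. *)
Fixpoint mpow (R : realType) (E : countType) (P : E -> E -> R) (n : nat)
    (i j : E) : R :=
  if n is m.+1 then fine (\esum_(k in [set: E]) (P i k * mpow P m k j)%:E)
  else (i == j)%:R.

Definition irreducible (R : realType) (E : countType)
    (P : E -> E -> R) : Prop :=
  forall i j, exists n : nat, (0 < mpow P n i j)%R.

(* The greatest common divisor of the return times [n >= 1] with
   [mpow P n i i > 0] is 1, i.e. their only common divisor is 1. *)
Definition aperiodic (R : realType) (E : countType)
    (P : E -> E -> R) : Prop :=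
  forall (i : E) (d : nat),
    (forall n : nat, (0 < n)%N -> (0 < mpow P n i i)%R -> (d %| n)%N) ->
    d = 1%N.

Definition stationary (R : realType) (E : countType) (P : E -> E -> R)
    (pi : E -> R) : Prop :=
  forall j, (pi j)%:E = \esum_(i in [set: E]) (pi i * P i j)%:E.

Definition ergodic (R : realType) (E : countType)
    (P : E -> E -> R) : Prop :=
  exists pi : E -> R,
    [/\ prob_distribution pi, stationary P pi &
      forall i : E,
        (fun n : nat => \esum_(j in [set: E]) `|mpow P n i j - pi j|%:E)
          @ \oo --> (0 : \bar R)].

(* When [y] is bounded above, the positive part of the sum is finite, so the sum
   is well defined in [-oo, +oo[; since [y] is real-valued, the inequality then
   forces it to be finite. *)
Definition solves_inequality (R : realType) (E : countType)
    (P : E -> E -> R) (H : {fset E}) (y : E -> R) : Prop :=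
  forall i : E,
    (y i)%:E <= signed_esum [set j | j \notin H] (fun j => (P i j * y j)%:E) + 1.

Definition max_on (R : realType) (E : countType) (H : {fset E})
    (y : E -> R) : \bar R :=
  \big[maxe/-oo]_(i <- H) (y i)%:E.

(* Main.v *)
(** Let [h_n(i) = E_i(min(sigma_H, n))]; each [h_n] is bounded and satisfies
    [h_{n+1} = 1 + Q h_n >= h_n], where [Q] is [P] with the columns in [H]
    deleted, so [h_n] solves the inequality.  A bounded above solution [y <= C]
    satisfies [y <= h_n + C P(sigma_H > n)] for all [n].  Both implications
    thus reduce to: the chain is ergodic iff [sup_n max_H h_n] is finite.

    If [p] is stationary, then [sum_i p_i h_{n+1}(i) = 1 + sum_{j notin H} p_j
    h_n(j)], whence [p_i h_n(i) <= 1] on [H] (half of Kac's formula).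

    Conversely, suppose [h_n <= M] on [H].  The Cesaro averages of [P^n(i, .)]
    asymptotically give [H] mass at least [1/M]; as [H] is finite, their limit
    along an ultrafilter is non-zero.  It is subinvariant by Fatou, hence
    invariant because its total mass is finite, and it normalises to a
    stationary distribution [p].

    For the convergence, put [f_n(k) = P^n(i, k) / p_k <= 1 / p_i].  Then
    [sum_k p_k f_n(k)^2] decreases by at least
    [p_k P(k, j) (f_n(k) - f_{n+1}(j))^2] at each step, so
    [f_n(k) - f_{n+m}(j) -> 0] whenever [P^m(k, j) > 0].  The [m] for which
    [f_n(k) - f_{n+m}(k) -> 0] are closed under subtraction and include all
    return times, so by aperiodicity [m = 1] is one of them.  Hence
    [f_n(k) - f_n(j) -> 0] for all [k], [j], and [f_n -> 1] by dominated
    convergence. *)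
Require Import Defs.
From HB Require Import structures.
From mathcomp Require Import all_boot all_order all_algebra finmap.
From mathcomp Require Import all_classical all_reals all_analysis.
From mathcomp Require Import ring lra.

Set Implicit Arguments.
Unset Strict Implicit.
Unset Printing Implicit Defensive.

Import Order.TTheory GRing.Theory Num.Theory.
Import numFieldNormedType.Exports.

Local Open Scope classical_set_scope.
Local Open Scope ring_scope.

(** * Sums of non-negative families *)

Section NonnegativeSums.
Context {R : realType} {T : choiceType}.
Implicit Types (f g : T -> R) (s t : R).

(** A relation rather than a value: it carries non-negativity and finiteness along, so that sums are
    added, scaled and compared in [R]. *)
Definition nnsum f s : Prop :=
  (forall j, 0 <= f j) /\ (\esum_(j in [set: T]) (f j)%:E = s%:E)%E.

Lemma nnsum_ge0 f s : nnsum f s -> 0 <= s.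
Proof.
move=> [f0 fs]; rewrite -lee_fin -fs; apply: esum_ge0 => j _.
by rewrite lee_fin.
Qed.

Lemma nnsum_uniq f s t : nnsum f s -> nnsum f t -> s = t.
Proof. by move=> [_ fs] [_]; rewrite fs => -[]. Qed.

Lemma eq_nnsum f g s : f =1 g -> nnsum f s -> nnsum g s.
Proof. by move=> /funext ->. Qed.

Lemma nnsum_fine f : (forall j, 0 <= f j) ->
  (\esum_(j in [set: T]) (f j)%:E < +oo)%E ->
  nnsum f (fine (\esum_(j in [set: T]) (f j)%:E)%E).
Proof.
move=> f0 fs; split => //; rewrite fineK// ge0_fin_numE//.
by apply: esum_ge0 => j _; rewrite lee_fin.
Qed.

Lemma nnsum_bounded f t : (forall j, 0 <= f j) ->
  (\esum_(j in [set: T]) (f j)%:E <= t%:E)%E -> exists2 s, nnsum f s & s <= t.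
Proof.
move=> f0 ft; have fs := nnsum_fine f0 (le_lt_trans ft (ltry _)).
by exists (fine (\esum_(j in [set: T]) (f j)%:E)%E) => //; rewrite -lee_fin -fs.2.
Qed.

Lemma nnsum_dominated f g t : (forall j, 0 <= f j <= g j) -> nnsum g t ->
  exists2 s, nnsum f s & s <= t.
Proof.
move=> fg [g0 gt]; apply: nnsum_bounded => [j|]; first by case/andP: (fg j).
by rewrite -gt; apply: le_esum => j _; rewrite lee_fin; case/andP: (fg j).
Qed.

Lemma le_nnsum f g s t : (forall j, f j <= g j) -> nnsum f s -> nnsum g t ->
  s <= t.
Proof.
move=> fg [_ fs] [_ gt]; rewrite -lee_fin -fs -gt.
by apply: le_esum => j _; rewrite lee_fin.
Qed.

Lemma nnsumD f g s t : nnsum f s -> nnsum g t ->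
  nnsum (fun j => f j + g j) (s + t).
Proof.
move=> [f0 fs] [g0 gt]; split => [j|]; first exact: addr_ge0.
by rewrite EFinD -fs -gt -esumD// => j _; rewrite lee_fin.
Qed.

(** The bound [le] comes from finite partial sums; for non-zero [c], applying it to [c^-1] and
    [c * f] gives the converse. *)
Lemma nnsumZ c f s : 0 <= c -> nnsum f s -> nnsum (fun j => c * f j) (c * s).
Proof.
have le c' f' s' : 0 <= c' -> nnsum f' s' ->
    (\esum_(j in [set: T]) (c' * f' j)%:E <= (c' * s')%:E)%E.
  move=> c0 [f0 fs]; apply: ge_ereal_sup => _ [X [finX _] <-].
  rewrite fsbig_finite//= sumEFin -mulr_sumr lee_fin ler_wpM2l// -lee_fin -fs.
  rewrite -sumEFin; apply: ereal_sup_ubound; exists X => //.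
  by rewrite fsbig_finite.
move=> c0 fs; have f0 := fs.1; have cf0 j : 0 <= c * f j by exact: mulr_ge0.
have [cE|cneq0] := eqVneq c 0.
  by split=> //; rewrite cE mul0r esum1// => j _; rewrite mul0r.
have [u fu us] := nnsum_bounded cf0 (le _ _ _ c0 fs).
have cV0 : 0 <= c^-1 by rewrite invr_ge0.
have /le := fu => /(_ _ cV0); under eq_esum do rewrite mulKf//.
rewrite fs.2 lee_fin ler_pdivlMl ?lt0r ?cneq0// => su.
by have -> : c * s = u by apply/eqP; rewrite eq_le us su.
Qed.

Lemma nnsum_weighted w f t C : nnsum w t -> 0 <= C ->
  (forall j, 0 <= f j <= C) ->
  exists2 s, nnsum (fun j => w j * f j) s & s <= C * t.
Proof.
move=> wt C0 fC; apply: nnsum_dominated (nnsumZ C0 wt) => j.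
have w0 := wt.1; have /andP[f0 fle] := fC j.
by rewrite mulr_ge0//= [C * _]mulrC ler_wpM2l.
Qed.

Lemma nnsum_ge_term f s i : nnsum f s -> f i <= s.
Proof.
move=> [f0 fs]; rewrite -lee_fin -fs; apply: esum_ge; exists [set i].
  by split.
by rewrite fsbig_set1.
Qed.

Lemma nnsum_ge_fsum f s (F : {fset T}) : nnsum f s -> \sum_(j <- F) f j <= s.
Proof.
move=> [f0 fs]; rewrite -lee_fin -fs; apply: esum_ge; exists [set` F].
  by split.
by rewrite fsbig_finite//= set_fsetK sumEFin.
Qed.

Lemma nnsum_fsum_bounded f t : (forall j, 0 <= f j) ->
  (forall F : {fset T}, \sum_(j <- F) f j <= t) -> exists2 s, nnsum f s & s <= t.
Proof.
move=> f0 ft; apply: nnsum_bounded => //; apply: ge_ereal_sup => _ [X [finX _] <-].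
by rewrite fsbig_finite//= sumEFin lee_fin.
Qed.

Lemma nnsum_approx f s e : nnsum f s -> 0 < e ->
  exists F : {fset T}, s - e < \sum_(j <- F) f j.
Proof.
move=> [f0 fs] e0.
have : ((s - e)%:E < \esum_(j in [set: T]) (f j)%:E)%E.
  by rewrite fs lte_fin gtrBl.
move=> /ereal_sup_gt[_ [X [finX _] <-]]; rewrite fsbig_finite//= sumEFin lte_fin.
by move=> ?; exists (fset_set X).
Qed.

Lemma nnsum_fset f (F : {fset T}) : (forall j, 0 <= f j) ->
  nnsum (fun j => if j \in F then f j else 0) (\sum_(j <- F) f j).
Proof.
move=> f0; split => [j|]; first by case: ifP.
rewrite -sumEFin -[F in RHS]set_fsetK -fsbig_finite//= -esum_fset//; last first.
  by move=> j _; rewrite lee_fin.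
rewrite [RHS]esum_mkcond; apply: eq_esum => j _.
by rewrite mem_setE; case: ifP.
Qed.

Lemma nnsum_bigsum (I : Type) (r : seq I) (F : I -> T -> R) (S : I -> R) :
  (forall i, nnsum (F i) (S i)) ->
  nnsum (fun j => \sum_(i <- r) F i j) (\sum_(i <- r) S i).
Proof.
move=> FS; elim: r => [|i r IH].
  split => [j|]; rewrite big_nil// esum1// => j _.
  by rewrite big_nil.
rewrite big_cons; apply: eq_nnsum (nnsumD (FS i) IH) => j.
by rewrite big_cons.
Qed.

Lemma nnsum_eq0 f : nnsum f 0 -> forall j, f j = 0.
Proof.
by move=> f0 j; apply/eqP; rewrite eq_le f0.1 (nnsum_ge_term j f0).
Qed.

(** The difference [g - f] has a sum [u] with [s + u = s]; as [s] is finite, [u = 0]. *)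
Lemma nnsum_le_eq f g s : (forall j, f j <= g j) -> nnsum f s -> nnsum g s ->
  f =1 g.
Proof.
move=> fg fs gs j.
have [|u gfu _] := @nnsum_dominated (fun j => g j - f j) g s _ gs.
  by move=> k; rewrite subr_ge0 fg gerBl fs.1.
have su : s + u = s.
  apply: nnsum_uniq gs; apply: eq_nnsum (nnsumD fs gfu) => k.
  by rewrite addrC subrK.
have u0 : u = 0 by lra.
by rewrite u0 in gfu; have := nnsum_eq0 gfu j; lra.
Qed.

End NonnegativeSums.

Lemma nnsum_exchange (R : realType) (S T : choiceType) (a : S -> T -> R)
    (r : S -> R) (c : T -> R) (s : R) :
  (forall i, nnsum (a i) (r i)) -> (forall j, nnsum (a ^~ j) (c j)) ->
  nnsum r s -> nnsum c s.
Proof.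
move=> ar ac [r0 rs]; have a0 i j : 0 <= a i j by case: (ar i).
split=> [j|]; first exact: nnsum_ge0 (ac j).
rewrite -rs; under eq_esum => j _ do rewrite -(ac j).2.
under [RHS]eq_esum => i _ do rewrite -(ar i).2.
rewrite !esum_esum; try by move=> i j _ _; rewrite lee_fin.
rewrite (reindex_esum ([set: S] `*` [set: T]) _ (fun x => (x.2, x.1)))//.
split=> //=; first by move=> [i j] [i' j'] _ _ /= [-> ->].
by move=> [j i] _; exists (i, j).
Qed.

Lemma cvg_fsum (R : realType) (I : Type) (r : seq I) (S : Type)
    (F : set_system S) {FF : Filter F} (f : I -> S -> R) (l : I -> R) :
  (forall i, f i x @[x --> F] --> l i) ->
  \sum_(i <- r) f i x @[x --> F] --> \sum_(i <- r) l i.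
Proof. by move=> fl; apply: cvg_big => //; exact: add_continuous. Qed.

Section DominatedConvergence.
Context {R : realType} {T : choiceType}.

(** A finite [F] carries all but [d] of the mass of [w]: the sum over [F] tends to 0, and the rest
    is at most [|B| * d]. *)
Lemma nnsum_dominated_cvg (w : T -> R) (t B : R) (g : nat -> T -> R)
    (s : nat -> R) : nnsum w t -> (forall n j, 0 <= g n j <= B) ->
  (forall j, g n j @[n --> \oo] --> 0) ->
  (forall n, nnsum (fun j => w j * g n j) (s n)) -> s n @[n --> \oo] --> 0.
Proof.
move=> wt gB g0 gs; have w0 := wt.1.
apply/cvgr0Pnorm_lt => e e0.
pose d := e / 2 / (1 + `|B|).
have B1 : 0 < 1 + `|B| by rewrite ltr_pwDl.
have d0 : 0 < d by rewrite !divr_gt0.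
have [F wF] := nnsum_approx wt d0.
have lim0 : \sum_(j <- F) (w j * g n j) @[n --> \oo] --> 0.
  have : \sum_(j <- F) (w j * g n j) @[n --> \oo] --> \sum_(j <- F) (w j * 0).
    by apply: cvg_fsum => j; apply: cvgMl_tmp; exact: g0.
  by rewrite big1// => j _; rewrite mulr0.
have e20 : 0 < e / 2 by rewrite divr_gt0.
have /cvgr0Pnorm_lt/(_ _ e20) := lim0; apply: filterS => n sn.
rewrite ger0_norm; last exact: nnsum_ge0 (gs n).
have bound : s n + `|B| * \sum_(j <- F) w j <= \sum_(j <- F) (w j * g n j) + `|B| * t.
  have gn0 j : 0 <= w j * g n j by rewrite mulr_ge0//; case/andP: (gB n j).
  apply: le_nnsum (nnsumD (gs n) (nnsumZ (normr_ge0 B) (nnsum_fset F w0)))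
    (nnsumD (nnsum_fset F gn0) (nnsumZ (normr_ge0 B) wt)).
  move=> j; case: ifP => // _; rewrite mulr0 addr0 add0r mulrC ler_wpM2r//.
  by rewrite (le_trans _ (ler_norm B))//; case/andP: (gB n j).
have dE : d * (1 + `|B|) = e / 2 by rewrite /d divfK ?gt_eqF.
have := ler_norm (\sum_(j <- F) (w j * g n j)); have := normr_ge0 B.
nra.
Qed.

End DominatedConvergence.

(** * Powers of the transition matrix *)

Section TransitionPowers.
Context {R : realType} {E : countType}.
Variable P : E -> E -> R.
Hypothesis P_transition : transition_matrix P.

Lemma trans_ge0 i j : 0 <= P i j.
Proof. by case: (P_transition i). Qed.

Lemma nnsum_trans i : nnsum (P i) 1.
Proof. by case: (P_transition i). Qed.

Lemma mpow_itv n i j : 0 <= mpow P n i j <= 1.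
Proof.
elim: n i j => [|n IH] i j /=; first by case: (i == j); rewrite ?lexx ?ler01.
have [s ss] := nnsum_weighted (nnsum_trans i) ler01 (fun k => IH k j).
by rewrite mulr1 ss.2 /= (nnsum_ge0 ss).
Qed.

Lemma mpow_ge0 n i j : 0 <= mpow P n i j.
Proof. by case/andP: (mpow_itv n i j). Qed.

Lemma nnsum_mpowS n i j :
  nnsum (fun k => P i k * mpow P n k j) (mpow P n.+1 i j).
Proof.
have [s ss _] := nnsum_weighted (nnsum_trans i) ler01 (fun k => mpow_itv n k j).
by rewrite /= ss.2.
Qed.

Lemma nnsum_kronecker (i : E) (f : E -> R) : (forall j, 0 <= f j) ->
  nnsum (fun j => (i == j)%:R * f j) (f i).
Proof.
move=> f0; have := nnsum_fset [fset i]%fset f0; rewrite big_seq_fset1.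
apply: eq_nnsum => j; rewrite inE eq_sym.
by case: eqP; rewrite (mul1r, mul0r).
Qed.

Lemma nnsum_mpow n i : nnsum (mpow P n i) 1.
Proof.
elim: n i => [|n IH] i.
  apply: eq_nnsum (nnsum_kronecker i (fun=> ler01)) => j.
  by rewrite mulr1.
apply: (nnsum_exchange (a := fun k j => P i k * mpow P n k j)) (nnsum_trans i).
  by move=> k; rewrite -[X in nnsum _ X]mulr1; exact: nnsumZ (trans_ge0 i k) (IH k).
by move=> j; exact: nnsum_mpowS.
Qed.

(** [mpow] unfolds at the first step; this recursion at the last step follows the law started at [i]
    through time. *)
Lemma nnsum_mpowSr n i j :
  nnsum (fun k => mpow P n i k * P k j) (mpow P n.+1 i j).
Proof.
elim: n i => [|n IH] i.
  have -> : mpow P 1 i j = P i j.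
    apply: (nnsum_uniq (nnsum_mpowS 0 i j)).
    apply: eq_nnsum (nnsum_kronecker j (trans_ge0 i)) => k.
    by rewrite /= mulrC eq_sym.
  by apply: eq_nnsum (nnsum_kronecker i (trans_ge0 ^~ j)) => k.
apply: (nnsum_exchange (a := fun k l => P i k * (mpow P n k l * P l j)))
  (nnsum_mpowS n.+1 i j).
  by move=> k; exact: nnsumZ (trans_ge0 i k) (IH k).
move=> l; have := nnsumZ (trans_ge0 l j) (nnsum_mpowS n i l).
rewrite mulrC; apply: eq_nnsum => k; ring.
Qed.

Lemma mpowS_gt0 n i j : 0 < mpow P n.+1 i j ->
  exists k, 0 < P i k /\ 0 < mpow P n k j.
Proof.
move=> Pij; apply: contrapT => noth.
have : mpow P n.+1 i j = 0.
  apply: (nnsum_uniq (nnsum_mpowS n i j)).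
  split => [k|]; first by rewrite mulr_ge0// (trans_ge0, mpow_ge0).
  rewrite esum1// => k _; congr EFin; apply/eqP; rewrite mulf_eq0.
  apply: contra_notT noth; rewrite negb_or => /andP[Pik Pkj]; exists k.
  by rewrite !lt0r Pik Pkj trans_ge0 mpow_ge0.
by move=> Pij0; rewrite Pij0 ltxx in Pij.
Qed.

End TransitionPowers.

(** * The truncated hitting time *)

Section HittingTime.
Context {R : realType} {E : countType}.
Variables (P : E -> E -> R) (H : {fset E}).
Hypothesis P_transition : transition_matrix P.

(** Applying [P] to [taboo f] amounts to deleting the columns in [H], while every sum still ranges
    over the whole of [E]. *)
Definition taboo (f : E -> R) (j : E) : R := if j \in H then 0 else f j.

(* [survival n i] is P_i(sigma_H > n), and [trunc_hit n i] is
   E_i(min(sigma_H, n)). *)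
Fixpoint survival (n : nat) (i : E) : R :=
  if n is m.+1 then fine (\esum_(j in [set: E]) (P i j * taboo (survival m) j)%:E)
  else 1.

Definition trunc_hit (n : nat) (i : E) : R := \sum_(k < n) survival k i.

Lemma taboo_itv C (f : E -> R) : 0 <= C -> (forall j, 0 <= f j <= C) ->
  forall j, 0 <= taboo f j <= C.
Proof. by move=> C0 fC j; rewrite /taboo; case: ifP; rewrite ?lexx. Qed.

Lemma esum_taboo i (f : E -> R) :
  (\esum_(j in [set j | j \notin H]) (P i j * f j)%:E =
   \esum_(j in [set: E]) (P i j * taboo f j)%:E)%E.
Proof.
rewrite esum_mkcond; apply: eq_esum => j _; rewrite /taboo.
case: ifPn; first by rewrite inE /= => /negbTE ->.
by rewrite notin_setE /= => /negP; rewrite negbK => ->; rewrite mulr0.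
Qed.

Lemma survival_itv n i : 0 <= survival n i <= 1.
Proof.
elim: n i => [|n IH] i /=; first by rewrite ler01 lexx.
have [s ss] := nnsum_weighted (nnsum_trans P_transition i) ler01 (taboo_itv ler01 IH).
by rewrite mulr1 ss.2 /= (nnsum_ge0 ss).
Qed.

Lemma nnsum_survivalS n i :
  nnsum (fun j => P i j * taboo (survival n) j) (survival n.+1 i).
Proof.
have [s ss _] := nnsum_weighted (nnsum_trans P_transition i) ler01
  (taboo_itv ler01 (survival_itv n)).
by rewrite /= ss.2.
Qed.

Lemma survival_nincr n i : survival n.+1 i <= survival n i.
Proof.
elim: n i => [|n IH] i; first by case/andP: (survival_itv 1 i).
apply: le_nnsum (nnsum_survivalS n.+1 i) (nnsum_survivalS n i) => j.
by rewrite ler_wpM2l ?(trans_ge0 P_transition)// /taboo; case: ifP.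
Qed.

Lemma trunc_hitS n i : trunc_hit n.+1 i = trunc_hit n i + survival n i.
Proof. by rewrite /trunc_hit big_ord_recr. Qed.

Lemma trunc_hit_ge0 n i : 0 <= trunc_hit n i.
Proof. by apply: sumr_ge0 => k _; case/andP: (survival_itv k i). Qed.

Lemma trunc_hit_itv n i : 0 <= trunc_hit n i <= n%:R.
Proof.
rewrite trunc_hit_ge0 /=; elim: n => [|n IH]; first by rewrite /trunc_hit big_ord0.
by rewrite trunc_hitS -natr1 lerD//; case/andP: (survival_itv n i).
Qed.

Lemma trunc_hit_ndecr n i : trunc_hit n i <= trunc_hit n.+1 i.
Proof. by rewrite trunc_hitS lerDl; case/andP: (survival_itv n i). Qed.

(** Markov's inequality: [survival] is non-increasing in time, so each of the [n] terms of
    [trunc_hit n i] is at least [survival n i]. *)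
Lemma survival_markov n i : n%:R * survival n i <= trunc_hit n i.
Proof.
elim: n => [|n IH]; first by rewrite mul0r trunc_hit_ge0.
rewrite trunc_hitS -natr1 mulrDl mul1r lerD ?survival_nincr//.
by rewrite (le_trans _ IH)// ler_wpM2l// survival_nincr.
Qed.

Lemma nnsum_trunc_hitS n i :
  nnsum (fun j => P i j * taboo (trunc_hit n) j) (trunc_hit n.+1 i - 1).
Proof.
elim: n i => [|n IH] i.
  rewrite /trunc_hit big_ord_recr big_ord0 /= add0r subrr.
  have /nnsumZ-/(_ 0 (lexx 0)) := nnsum_trans P_transition i.
  rewrite mul0r; apply: eq_nnsum => j.
  by rewrite /taboo big_ord0; case: ifP; rewrite mul0r mulr0.
rewrite trunc_hitS addrAC.
apply: eq_nnsum (nnsumD (IH i) (nnsum_survivalS n i)) => j.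
by rewrite -mulrDr /taboo trunc_hitS; case: ifP => //; rewrite addr0.
Qed.

Lemma trunc_hit_solves n : solves_inequality P H (trunc_hit n).
Proof.
move=> i; rewrite /signed_esum.
have h0 j : (0 <= (P i j * trunc_hit n j)%:E)%E.
  by rewrite lee_fin mulr_ge0 ?trunc_hit_ge0 ?(trans_ge0 P_transition).
rewrite (eq_esum (b := fun j => (P i j * trunc_hit n j)%:E)); last first.
  by move=> j _; rewrite funeposE max_l ?h0.
rewrite [X in (_ - X)%E]esum1; last by move=> j _; rewrite funenegE max_r ?oppe_le0 ?h0.
rewrite esum_taboo (nnsum_trunc_hitS n i).2 sube0 -EFinD lee_fin subrK.
exact: trunc_hit_ndecr.
Qed.

Lemma solution_le (y : E -> R) C : 0 <= C -> (forall i, y i <= C) ->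
  solves_inequality P H y ->
  forall n i, y i <= trunc_hit n i + C * survival n i.
Proof.
move=> C0 yC ysol; elim=> [|n IH] i.
  by rewrite /trunc_hit big_ord0 add0r mulr1.
have T0 := trans_ge0 P_transition.
have := nnsumD (nnsum_trunc_hitS n i) (nnsumZ C0 (nnsum_survivalS n i)).
set z := fun j => trunc_hit n j + C * survival n j.
have z0 j : 0 <= z j.
  rewrite addr_ge0 ?trunc_hit_ge0// mulr_ge0//.
  by case/andP: (survival_itv n j).
move/(@eq_nnsum _ _ _ (fun j => P i j * taboo z j)) => /(_ _)[j|_ zs].
  by rewrite /taboo /z; case: ifP => _; ring.
have -> : trunc_hit n.+1 i + C * survival n.+1 i =
  trunc_hit n.+1 i - 1 + C * survival n.+1 i + 1 by ring.
rewrite -lee_fin EFinD -zs -esum_taboo.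
apply: le_trans (ysol i) _; rewrite leeD2r//.
(* Dropping the negative part only raises the sum; the positive part is at most [P i j * z j]
   because [z] is non-negative. *)
apply: (@le_trans _ _ (\esum_(j in [set j | j \notin H])
    (fun j => (P i j * y j)%:E)^\+ j)%E).
  by rewrite /signed_esum geeDl// oppe_le0 esum_ge0//.
apply: le_esum => j _; rewrite funeposE ge_max !lee_fin mulr_ge0// andbT.
by rewrite ler_wpM2l ?IH.
Qed.

Lemma stationary_trunc_hit (p : E -> R) : prob_distribution p ->
  stationary P p -> forall n i, i \in H -> p i * trunc_hit n i <= 1.
Proof.
move=> p1 pst n i iH; have p0 := p1.1.
(* Truncation makes [B] finite, so that it can be cancelled from both sides at the end. *)
have [B sB _] := nnsum_weighted p1 (ler0n _ n)
  (taboo_itv (ler0n _ n) (trunc_hit_itv n)).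
have sB1 : nnsum (fun k => p k * (trunc_hit n.+1 k - 1)) B.
  apply: (nnsum_exchange (a := fun j k => p k * (P k j * taboo (trunc_hit n) j))) sB.
    move=> j.
    have pj : nnsum (fun k => p k * P k j) (p j).
      by split=> [k|]; [rewrite mulr_ge0 ?(trans_ge0 P_transition)|rewrite pst].
    have t0 : 0 <= taboo (trunc_hit n) j.
      by rewrite /taboo; case: ifP => //; rewrite trunc_hit_ge0.
    rewrite mulrC; apply: eq_nnsum (nnsumZ t0 pj) => k; ring.
  by move=> k; exact: nnsumZ (nnsum_trunc_hitS n k).
have ph0 j : 0 <= p j * trunc_hit n.+1 j by rewrite mulr_ge0 ?trunc_hit_ge0.
have := nnsumD (nnsum_fset [fset i]%fset ph0) sB.
have sA : nnsum (fun k => p k * trunc_hit n.+1 k) (1 + B).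
  by apply: eq_nnsum (nnsumD p1 sB1) => k; ring.
move/le_nnsum => /(_ _ _ _ sA); rewrite big_seq_fset1 lerD2r => le1.
rewrite (le_trans _ (le1 _))//; first by rewrite ler_wpM2l ?trunc_hit_ndecr.
move=> j; rewrite inE /taboo; case: eqP => [->|_]; first by rewrite iH mulr0 addr0.
rewrite add0r ler_wpM2l//; case: ifP => _; first exact: trunc_hit_ge0.
exact: trunc_hit_ndecr.
Qed.

End HittingTime.

(** * Convergence to a stationary distribution *)

Section ErgodicTheorem.
Context {R : realType} {E : countType}.
Variables (P : E -> E -> R) (p : E -> R).
Hypothesis P_transition : transition_matrix P.
Hypothesis P_irreducible : irreducible P.
Hypothesis p_prob : prob_distribution p.
Hypothesis p_stationary : stationary P p.

Let p_ge0 k : 0 <= p k. Proof. exact: p_prob.1. Qed.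
Let P_ge0 k j : 0 <= P k j. Proof. exact: trans_ge0. Qed.

Lemma nnsum_stationary_mpow n j : nnsum (fun i => p i * mpow P n i j) (p j).
Proof.
elim: n j => [|n IH] j.
  apply: eq_nnsum (nnsum_kronecker j p_ge0) => i.
  by rewrite /= mulrC eq_sym.
apply: (nnsum_exchange (a := fun k i => p i * (P i k * mpow P n k j))) (IH j).
  move=> k.
  have pk : nnsum (fun i => p i * P i k) (p k).
    by split=> [i|]; [rewrite mulr_ge0|rewrite p_stationary].
  rewrite mulrC.
  apply: eq_nnsum (nnsumZ (mpow_ge0 P_transition n k j) pk) => i; ring.
by move=> i; exact: nnsumZ (nnsum_mpowS P_transition n i j).
Qed.

Lemma stationary_gt0 j : 0 < p j.
Proof.
have [i pi] : exists i, 0 < p i.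
  have [F] := nnsum_approx p_prob (@ltr01 R); rewrite subrr => sF.
  apply: contrapT => noth; move: sF; rewrite big1 ?ltxx// => i _.
  apply/eqP; rewrite eq_le p_ge0 andbT leNgt; apply/negP => pi.
  by apply: noth; exists i.
have [n Pn] := P_irreducible i j.
apply: lt_le_trans (nnsum_ge_term i (nnsum_stationary_mpow n j)).
exact: mulr_gt0.
Qed.

Variable i : E.

Definition density (n : nat) (k : E) : R := mpow P n i k / p k.
Local Notation f := density.

Lemma mulp_density n k : p k * f n k = mpow P n i k.
Proof. by rewrite mulrC divfK// gt_eqF// stationary_gt0. Qed.

(** The upper bound keeps only the term [i] of the sum that expresses the invariance of [p] under
    [n] steps. *)
Lemma density_itv n k : 0 <= f n k <= (p i)^-1.
Proof.
rewrite /f divr_ge0 ?(mpow_ge0 P_transition)//= ler_pdivrMr ?stationary_gt0//.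
rewrite ler_pdivlMl ?stationary_gt0//.
exact: (nnsum_ge_term i (nnsum_stationary_mpow n k)).
Qed.

Lemma nnsum_density n : nnsum (fun k => p k * f n k) 1.
Proof.
by apply: eq_nnsum (nnsum_mpow P_transition n i) => k; rewrite mulp_density.
Qed.

Lemma nnsum_densityS n j :
  nnsum (fun k => p k * P k j * f n k) (p j * f n.+1 j).
Proof.
rewrite mulp_density; apply: eq_nnsum (nnsum_mpowSr P_transition n i j) => k.
by rewrite -mulp_density mulrAC.
Qed.

(* [density n.+1 j] is the mean of [density n] under the time-reversed kernel
   k |-> p k * P k j / p j, so its square falls short of the mean square by the
   variance. *)
Lemma density_variance n j r k : nnsum (fun l => p l * P l j * f n l ^+ 2) r ->
  p j * f n.+1 j ^+ 2 + p k * P k j * (f n k - f n.+1 j) ^+ 2 <= r.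
Proof.
move=> sr; set F := f n.+1 j.
have w0 l : 0 <= p l * P l j by rewrite mulr_ge0.
have F0 : 0 <= F by case/andP: (density_itv n.+1 j).
have pj : nnsum (fun l => p l * P l j) (p j).
  by split=> [l|]; [rewrite mulr_ge0|rewrite p_stationary].
have sL := nnsumD sr (nnsumZ (sqr_ge0 F) pj).
have v0 l : 0 <= p l * P l j * (f n l - F) ^+ 2 by rewrite mulr_ge0 ?sqr_ge0.
have F20 : 0 <= 2 * F by rewrite mulr_ge0.
have sR := nnsumD (nnsum_fset [fset k]%fset v0) (nnsumZ F20 (nnsum_densityS n j)).
rewrite big_seq_fset1 in sR.
(* This sums [2 * F * f n l <= f n l ^+ 2 + F ^+ 2] against the weights [p l * P l j], keeping the
   gap [(f n l - F) ^+ 2] at [l = k] only. *)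
suff : p k * P k j * (f n k - F) ^+ 2 + 2 * F * (p j * F) <= r + F ^+ 2 * p j.
  by rewrite -/F; lra.
apply: le_nnsum sR sL => l; case: ifP => _.
  by rewrite le_eqVlt; apply/orP; left; apply/eqP; ring.
rewrite add0r -subr_ge0; apply: le_trans (v0 l) _.
by rewrite le_eqVlt; apply/orP; left; apply/eqP; ring.
Qed.

(** The witness [c n] is the sum of [p k * f n k ^+ 2] over [k]. Summing [density_variance] over the
    target states, with the gap kept at [j] alone, gives the decrease. *)
Lemma density_energy : exists c : nat -> R,
  (forall n, 0 <= c n) /\
  (forall n k j, p k * P k j * (f n k - f n.+1 j) ^+ 2 <= c n - c n.+1).
Proof.
have B0 : 0 <= (p i)^-1 ^+ 2 by rewrite sqr_ge0.
have f2 n k : 0 <= f n k ^+ 2 <= (p i)^-1 ^+ 2.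
  have /andP[f0 fB] := density_itv n k.
  by rewrite sqr_ge0 /= lerXn2r// nnegrE ?invr_ge0.
have /choice[c cE] : forall n, exists s, nnsum (fun k => p k * f n k ^+ 2) s.
  by move=> n; have [s ss _] := nnsum_weighted p_prob B0 (f2 n); exists s.
exists c; split => [n|n k j]; first exact: nnsum_ge0 (cE n).
have /choice[r rE] : forall l, exists s, nnsum (fun m => p m * P m l * f n m ^+ 2) s.
  move=> l.
  have pl : nnsum (fun m => p m * P m l) (p l).
    by split=> [m|]; [rewrite mulr_ge0|rewrite p_stationary].
  by have [s ss _] := nnsum_weighted pl B0 (f2 n); exists s.
have rc : nnsum r (c n).
  apply: (nnsum_exchange (a := fun m l => p m * P m l * f n m ^+ 2)) (cE n) => //.
  move=> m; have pf0 : 0 <= p m * f n m ^+ 2 by rewrite mulr_ge0 ?sqr_ge0.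
  have := nnsumZ pf0 (nnsum_trans P_transition m).
  by rewrite mulr1; apply: eq_nnsum => l; ring.
have v0 l : 0 <= p k * P k l * (f n k - f n.+1 l) ^+ 2.
  by rewrite mulr_ge0 ?sqr_ge0// mulr_ge0.
have := nnsumD (cE n.+1) (nnsum_fset [fset j]%fset v0).
rewrite big_seq_fset1 lerBrDl => /le_nnsum; apply; last exact: rc.
move=> l; apply: le_trans (density_variance k (rE l)).
by rewrite lerD2l; case: ifP.
Qed.

(** The lag [m] records the length of a path from [k] to [j]; aperiodicity later removes it. *)
Definition asymp (k j : E) (m : nat) : Prop :=
  f n k - f (n + m)%N j @[n --> \oo] --> (0 : R).

(** The energy [c] is non-increasing and non-negative, so its decrements vanish; they dominate the
    squared gap times the positive weight [p k * P k j]. *)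
Lemma asymp_step k j : 0 < P k j -> asymp k j 1.
Proof.
move=> Pkj; have [c [c0 cstep]] := density_energy.
have w0 : 0 < p k * P k j by rewrite mulr_gt0 ?stationary_gt0.
have cdecr : nonincreasing_seq c.
  apply/nonincreasing_seqP => n; rewrite -subr_ge0; apply: le_trans (cstep n k j).
  by rewrite mulr_ge0 ?sqr_ge0 ?ltW.
have ccvg : cvgn c.
  by apply: nonincreasing_is_cvgn => //; exists 0 => _ [n _ <-].
have dc : c n - c n.+1 @[n --> \oo] --> (0 : R).
  have -> : (0 : R) = limn c - limn c by rewrite subrr.
  by apply: cvgB => //; rewrite (cvg_shiftS c).
apply/cvgr0Pnorm_lt => e e0.
have e1 : 0 < p k * P k j * e ^+ 2 by rewrite mulr_gt0// exprn_gt0.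
have /cvgr0Pnorm_lt/(_ _ e1) := dc; apply: filterS => n cn.
rewrite addn1 -(@ltr_pXn2r _ 2)// ?nnegrE ?(ltW e0)// real_normK ?num_real//.
rewrite -(ltr_pM2l w0); apply: le_lt_trans (cstep n k j) _.
exact: le_lt_trans (ler_norm _) cn.
Qed.

Lemma asymp_refl k : asymp k k 0.
Proof.
by rewrite /asymp; under eq_fun do rewrite addn0 subrr; exact: cvg_cst.
Qed.

Lemma asymp_trans k l j a b : asymp k l a -> asymp l j b -> asymp k j (a + b).
Proof.
move=> kl; rewrite /asymp -(cvg_shiftn a) => lj.
have -> : (fun n => f n k - f (n + (a + b))%N j) =
    (fun n => f n k - f (n + a)%N l) \+
    (fun n => f (n + a)%N l - f (n + a + b)%N j).
  by apply/funext => n /=; rewrite addnA addrA subrK.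
by rewrite -[0]addr0; exact: cvgD kl lj.
Qed.

(** Both [k] at time [n] and [l] at time [n + (b - a)] are compared with [j] at time [n + b]. *)
Lemma asymp_subtract k l j a b : (a <= b)%N -> asymp k j b -> asymp l j a ->
  asymp k l (b - a).
Proof.
move=> ab kj; rewrite /asymp -(cvg_shiftn (b - a)%N) => lj.
have -> : (fun n => f n k - f (n + (b - a))%N l) =
    (fun n => f n k - f (n + b)%N j) \-
    (fun n => f (n + (b - a))%N l - f (n + (b - a) + a)%N j).
  by apply/funext => n /=; rewrite -addnA subnK// opprB addrA subrK.
by rewrite -[0]subr0; exact: cvgB kj lj.
Qed.

Lemma asymp_mpow m k j : 0 < mpow P m k j -> asymp k j m.
Proof.
elim: m k => [|m IH] k.
  by rewrite /=; case: eqP => [-> _|_]; [exact: asymp_refl|rewrite ltxx].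
move=> /(mpowS_gt0 P_transition)[l [Pkl Plj]]; rewrite -add1n.
exact: asymp_trans (asymp_step Pkl) (IH _ Plj).
Qed.

Hypothesis P_aperiodic : aperiodic P.

Lemma asymp_shift k m : asymp k k m.
Proof.
suff a1 : asymp k k 1.
  elim: m => [|m IH]; first exact: asymp_refl.
  by rewrite -addn1; exact: asymp_trans IH a1.
have exA : exists n, (0 < n)%N && `[< asymp k k n >].
  (* Without a positive lag there is no return time either, so 2 divides all of them vacuously. *)
  apply: contrapT => noA; suff : (2 = 1)%N by [].
  apply: (P_aperiodic (i := k)) => n n0 Pn; case: noA; exists n.
  by rewrite n0; exact/asboolP/asymp_mpow.
case: (ex_minnP exA) => d /andP[d0 /asboolP Ad dmin].
suff <- : d = 1%N by [].
apply: (P_aperiodic (i := k)) => n _ /asymp_mpow An.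
(* Subtracting multiples of the least positive lag [d] from a return time [n] leaves the lag
   [n %% d], which minimality forces to be 0. *)
have An' q : (q * d <= n)%N -> asymp k k (n - q * d).
  elim: q => [|q IH] qd; first by rewrite subn0.
  have qd' : (q * d <= n)%N by rewrite (leq_trans _ qd)// mulSn leq_addl.
  rewrite mulSnr subnDA; apply: asymp_subtract Ad; last exact: IH.
  by rewrite leq_subRL// -mulSnr.
have := An' _ (leq_divM n d); rewrite {1}(divn_eq n d) addKn => Ar.
rewrite /dvdn; case: posnP => // r0.
have : (d <= n %% d)%N by apply: dmin; rewrite r0; exact/asboolP.
by rewrite leqNgt ltn_pmod.
Qed.

(** A path of length [a] from [j] to [k] gives the lag [a], and the time shift by [a] at [k] cancels
    it. *)
Lemma density_uniform j k : f n j - f n k @[n --> \oo] --> (0 : R).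
Proof.
have [a /asymp_mpow jk] := P_irreducible j k.
have := asymp_subtract (leqnn a) jk (asymp_shift k a).
by rewrite /asymp subnn; under eq_fun do rewrite addn0.
Qed.

(** As [f n] has [p]-mean 1, its distance to 1 at [k] is at most the [p]-mean over [j] of
    [|f n k - f n j|]. *)
Lemma density_cvg k : f n k - 1 @[n --> \oo] --> (0 : R).
Proof.
have gB n j : 0 <= `|f n k - f n j| <= (p i)^-1.
  have /andP[? ?] := density_itv n k; have /andP[? ?] := density_itv n j.
  rewrite normr_ge0 ler_norml /=; apply/andP; split; lra.
have B0 : 0 <= (p i)^-1 by rewrite invr_ge0.
have /choice[s sE] : forall n, exists s, nnsum (fun j => p j * `|f n k - f n j|) s.
  by move=> n; have [s ss _] := nnsum_weighted p_prob B0 (gB n); exists s.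
have s0 : s n @[n --> \oo] --> (0 : R).
  apply: nnsum_dominated_cvg p_prob gB _ sE => j.
  rewrite -(normr0 R); apply: cvg_norm; exact: density_uniform.
have fs n : `|f n k - 1| <= s n.
  have f0 : 0 <= f n k by case/andP: (density_itv n k).
  have := nnsumZ f0 p_prob; rewrite mulr1 => sk.
  have le1 : f n k <= 1 + s n.
    apply: le_nnsum sk (nnsumD (nnsum_density n) (sE n)) => j.
    rewrite [f n k * _]mulrC -mulrDr ler_wpM2l//.
    by have := ler_norm (f n k - f n j); lra.
  have le2 : 1 <= f n k + s n.
    apply: le_nnsum (nnsum_density n) (nnsumD sk (sE n)) => j.
    rewrite [f n k * _]mulrC -mulrDr ler_wpM2l//.
    by have := ler_norm (f n j - f n k); rewrite distrC; lra.
  by rewrite ler_norml; apply/andP; split; lra.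
apply/cvgr0Pnorm_lt => e e0; have /cvgr0Pnorm_lt/(_ _ e0) := s0.
apply: filterS => n; apply: le_lt_trans.
exact: le_trans (fs n) (ler_norm _).
Qed.

Lemma mpow_cvg :
  (\esum_(j in [set: E]) `|mpow P n i j - p j|%:E @[n --> \oo] --> (0 : \bar R))%E.
Proof.
have gB n j : 0 <= `|f n j - 1| <= (p i)^-1 + 1.
  have /andP[? ?] := density_itv n j.
  rewrite normr_ge0 ler_norml /=; apply/andP; split; lra.
have B0 : 0 <= (p i)^-1 + 1 by rewrite addr_ge0 ?invr_ge0.
have /choice[s sE] : forall n, exists s, nnsum (fun j => p j * `|f n j - 1|) s.
  by move=> n; have [s ss _] := nnsum_weighted p_prob B0 (gB n); exists s.
have s0 : s n @[n --> \oo] --> (0 : R).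
  apply: nnsum_dominated_cvg p_prob gB _ sE => j.
  rewrite -(normr0 R); apply: cvg_norm; exact: density_cvg.
have -> : (fun n => \esum_(j in [set: E]) `|mpow P n i j - p j|%:E)%E = EFin \o s.
  apply/funext => n /=; rewrite -(sE n).2; apply: eq_esum => j _; congr EFin.
  by rewrite -mulp_density -{2}(mulr1 (p j)) -mulrBr normrM ger0_norm.
by apply: cvg_EFin => //; exact: nearW.
Qed.

End ErgodicTheorem.

(** * Existence of a stationary distribution *)

(** Compactness of the unit interval yields all coordinate limits along one ultrafilter, in place of
    a diagonal subsequence. *)
Lemma ultra_cvg_itv01 (R : realType) (T : Type) (a : nat -> T -> R) :
  (forall n j, 0 <= a n j <= 1) ->
  exists (U : set_system nat) (mu : T -> R),
    [/\ ProperFilter U, \oo `<=` U & forall j, a n j @[n --> U] --> mu j].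
Proof.
move=> a01; have [U [UU ooU]] := ultraFilterLemma eventually_filter.
suff /choice[mu muE] : forall j, exists m, a n j @[n --> U] --> (m : R).
  by exists U, mu; split => //; exact: ultra_proper.
move=> j; have : compact `[(0 : R), 1] by exact: segment_compact.
rewrite compact_ultra => /(_ (a n j @[n --> U])) [||m [_ am]]; last by exists m.
- split; first exact: fmap_proper_filter.
  move=> G GG UG; apply/seteqP; split => // A GA.
  have [//|UA] := in_ultra_setVsetC ((fun n => a n j) @^-1` A) UU.
  have /UG GAc : (a n j @[n --> U]) (~` A) by [].
  suff : G set0 by case/(filter_not_empty G).
  by rewrite -(setICr A); exact: filterI.
- by apply: (@filterE _ U) => n; rewrite /= in_itv /= a01.
Qed.

Lemma sum_ord_shift (V : zmodType) (g : nat -> V) n :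
  \sum_(t < n) g t.+1 = \sum_(t < n) g t + g n - g 0%N.
Proof.
elim: n => [|n IH]; first by rewrite !big_ord0 add0r subrr.
by rewrite !big_ord_recr /= IH addrAC.
Qed.

Section PositiveRecurrence.
Context {R : realType} {E : countType}.
Variables (P : E -> E -> R) (H : {fset E}) (M : R) (i : E).
Hypothesis P_transition : transition_matrix P.
Hypothesis iH : i \in H.
Hypothesis hit_bounded : forall n j, j \in H -> trunc_hit P H n j <= M.

Let P_ge0 k j : 0 <= P k j. Proof. exact: trans_ge0. Qed.
Let Pn_ge0 n k j : 0 <= mpow P n k j. Proof. exact: mpow_ge0. Qed.
Let M_ge0 : 0 <= M.
Proof. by apply: le_trans (hit_bounded 0 iH); rewrite trunc_hit_ge0. Qed.

Local Notation ht := (trunc_hit P H).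
Local Notation visits n := (\sum_(j <- H) mpow P n i j).

(* Off H the hitting time drops by one on average in each step, and a visit to H
   raises it by at most M, so that the chain spends a fraction at least 1 / M of
   the time in H. *)
Lemma mean_hit_step n K s t :
  nnsum (fun j => mpow P n.+1 i j * ht K j) s ->
  nnsum (fun j => mpow P n i j * ht K.+1 j) t ->
  s + 1 <= t + M * visits n.+1.
Proof.
move=> sE tE.
have /choice[g gE] : forall k, exists s, nnsum (fun j => P k j * ht K j) s.
  move=> k; have [u uE _] := nnsum_weighted (nnsum_trans P_transition k) (ler0n R K)
    (trunc_hit_itv H P_transition K).
  by exists u.
have gs : nnsum (fun k => mpow P n i k * g k) s.
  apply: (nnsum_exchange (a := fun j k => mpow P n i k * (P k j * ht K j))) sE.
    move=> j; have h0 := trunc_hit_ge0 H P_transition K j.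
    rewrite mulrC.
    by apply: eq_nnsum (nnsumZ h0 (nnsum_mpowSr P_transition n i j)) => k; ring.
  by move=> k; exact: nnsumZ (gE k).
have visE : nnsum (fun k => mpow P n i k * \sum_(j <- H) P k j) (visits n.+1).
  apply: eq_nnsum (nnsum_bigsum H (fun j => nnsum_mpowSr P_transition n i j)) => k.
  by rewrite mulr_sumr.
apply: le_nnsum (nnsumD gs (nnsum_mpow P_transition n i)) (nnsumD tE (nnsumZ M_ge0 visE)).
move=> k; suff : g k + 1 <= ht K.+1 k + M * \sum_(j <- H) P k j.
  by move/(ler_wpM2l (Pn_ge0 n i k)); rewrite !mulrDr mulr1 mulrCA.
suff : g k <= ht K.+1 k - 1 + M * \sum_(j <- H) P k j by lra.
apply: le_nnsum (gE k) (nnsumD (nnsum_trunc_hitS H P_transition K k)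
  (nnsumZ M_ge0 (nnsum_fset H (P_ge0 k)))) => j.
rewrite /taboo; case: ifPn => jH; last by rewrite mulr0 addr0.
by rewrite mulr0 add0r mulrC ler_wpM2r// hit_bounded.
Qed.

Lemma visits_ge n : n%:R <= M + M * \sum_(t < n) visits t.+1.
Proof.
have /choice[e eE] : forall nK : nat * nat, exists s,
    nnsum (fun j => mpow P nK.1 i j * ht nK.2 j) s.
  move=> [m K]; have [u uE _] := nnsum_weighted (nnsum_mpow P_transition m i)
    (ler0n R K) (trunc_hit_itv H P_transition K).
  by exists u.
(* Each step back in time raises the truncation level by one. With [m = n] and [K = 0] the left mean
   is non-negative and the right one is [ht n i <= M]. *)
have iter m K : e (m, K) + m%:R <= e (0%N, (m + K)%N) + M * \sum_(t < m) visits t.+1.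
  elim: m K => [|m IH] K; first by rewrite big_ord0 mulr0.
  have step := mean_hit_step (eE (m.+1, K)) (eE (m, K.+1)).
  have := IH K.+1; rewrite addnS addSn -natr1 big_ord_recr /= mulrDr; lra.
have := iter n 0%N; rewrite addn0.
have -> : e (0%N, n) = ht n i.
  apply: nnsum_uniq (eE (0%N, n)) _ => /=.
  by apply: nnsum_kronecker => j; exact: trunc_hit_ge0.
have := nnsum_ge0 (eE (n, 0%N)); have := hit_bounded n iH; lra.
Qed.

Definition cesaro (n : nat) (j : E) : R := n.+1%:R^-1 * \sum_(t < n.+1) mpow P t i j.

Lemma nnsum_cesaro n : nnsum (cesaro n) 1.
Proof.
have n0 : 0 <= n.+1%:R^-1 :> R by rewrite invr_ge0.
have := nnsumZ n0 (nnsum_bigsum (index_enum 'I_n.+1)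
  (fun t : 'I_n.+1 => nnsum_mpow P_transition t i)).
by rewrite big_const_ord iter_addr_0 mulVf// pnatr_eq0.
Qed.

(** Advancing time by one telescopes: the two sums differ by [mpow P n.+1 i j - mpow P 0 i j], which
    is at most 1. *)
Lemma cesaro_subinvariant n j : exists2 s,
  nnsum (fun k => cesaro n k * P k j) s & s <= cesaro n j + n.+1%:R^-1.
Proof.
have n0 : 0 <= n.+1%:R^-1 :> R by rewrite invr_ge0.
exists (n.+1%:R^-1 * \sum_(t < n.+1) mpow P t.+1 i j).
  have := nnsumZ n0 (nnsum_bigsum (index_enum 'I_n.+1)
    (fun t : 'I_n.+1 => nnsum_mpowSr P_transition t i j)).
  by apply: eq_nnsum => k; rewrite /cesaro -mulrA mulr_suml.
rewrite /cesaro -[X in _ + X]mulr1 -mulrDr ler_wpM2l//.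
rewrite (sum_ord_shift (fun t => mpow P t i j)).
have /andP[? ?] := mpow_itv P_transition n.+1 i j.
by have := Pn_ge0 0 i j; lra.
Qed.

(** [visits_ge] counts the times 1 to [n]; including time 0 only adds visits, and normalising by
    [n.+1] instead of [n] accounts for the 1 in [M + 1]. *)
Lemma cesaro_visits n : 1 <= n.+1%:R^-1 * (M + 1) + M * \sum_(j <- H) cesaro n j.
Proof.
have n0 : 0 < n.+1%:R :> R by rewrite ltr0n.
rewrite -mulr_sumr mulrCA -mulrDr mulrC ler_pdivlMr// mul1r.
rewrite exchange_big -natr1 big_ord_recr.
have := visits_ge n; rewrite (sum_ord_shift (fun t => visits t)) !mulrDr mulrN.
have : 0 <= M * visits 0%N by rewrite mulr_ge0// sumr_ge0.
lra.
Qed.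

Lemma stationary_exists : exists p : E -> R, prob_distribution p /\ stationary P p.
Proof.
have c0 n j : 0 <= cesaro n j by exact: (nnsum_cesaro n).1.
have c01 n j : 0 <= cesaro n j <= 1.
  by rewrite c0 (nnsum_ge_term j (nnsum_cesaro n)).
have [U [mu [UF ooU muE]]] := ultra_cvg_itv01 c01.
have invU : n.+1%:R^-1 @[n --> U] --> (0 : R).
  move=> A A0; apply: ooU; exact: (@cvg_harmonic R A A0).
have mu0 j : 0 <= mu j by apply: (cvgr_to_ge (muE j)); exact: nearW.
(* Only finite partial sums pass to the limit, so mass may escape and [m] may be below 1. *)
have [m mum m1] : exists2 m, nnsum mu m & m <= 1.
  apply: nnsum_fsum_bounded => // F.
  have cF : \sum_(j <- F) cesaro n j @[n --> U] --> \sum_(j <- F) mu j.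
    exact: cvg_fsum.
  apply: (cvgr_to_le cF); apply: nearW => n.
  exact: nnsum_ge_fsum (nnsum_cesaro n).
have /choice[nu nuE] : forall j, exists s, nnsum (fun k => mu k * P k j) s /\ s <= mu j.
  move=> j; have [k|F|s ss sle] := @nnsum_fsum_bounded _ _ (fun k => mu k * P k j) (mu j).
  - by rewrite mulr_ge0.
  - have cF : \sum_(k <- F) (cesaro n k * P k j) @[n --> U] -->
        \sum_(k <- F) (mu k * P k j).
      by apply: cvg_fsum => k; exact: cvgMr_tmp.
    have cj : cesaro n j + n.+1%:R^-1 @[n --> U] --> mu j.
      by rewrite -[mu j]addr0; exact: cvgD (muE j) invU.
    apply: (ler_cvg_to cF cj); apply: nearW => n.
    have [s ss] := cesaro_subinvariant n j.
    exact: le_trans (nnsum_ge_fsum F ss).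
  - by exists s.
(* Since [nu] and [mu] share the finite total [m], the inequality [nu <= mu] is an equality
   everywhere. *)
have num : nnsum nu m.
  apply: (nnsum_exchange (a := fun k j => mu k * P k j)) mum => [k|j].
    by rewrite -[X in nnsum _ X]mulr1; exact: nnsumZ (nnsum_trans P_transition k).
  exact: (nuE j).1.
have numu : nu =1 mu by apply: nnsum_le_eq num mum => j; exact: (nuE j).2.
(* The limit of [cesaro_visits] bounds [M] times the [mu]-mass of the finite set [H] below by 1, so
   [mu] does not vanish. *)
have m0 : 0 < m.
  have lim1 : 1 <= 0 * (M + 1) + M * \sum_(j <- H) mu j.
    have cH : n.+1%:R^-1 * (M + 1) + M * \sum_(j <- H) cesaro n j @[n --> U] -->
        0 * (M + 1) + M * \sum_(j <- H) mu j.
      apply: cvgD; first exact: cvgMr_tmp.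
      by apply: cvgMl_tmp; exact: cvg_fsum.
    by apply: (cvgr_to_ge cH); apply: nearW => n; exact: cesaro_visits.
  have := nnsum_ge_fsum H mum; rewrite lt_neqAle (nnsum_ge0 mum) andbT => Hm.
  apply/eqP => m0; move: lim1; rewrite -m0 in Hm.
  have : M * \sum_(j <- H) mu j <= 0 by rewrite mulr_ge0_le0.
  lra.
have mV0 : 0 <= m^-1 by rewrite invr_ge0 ltW.
exists (fun j => m^-1 * mu j); split.
  by have := nnsumZ mV0 mum; rewrite mulVf// gt_eqF.
move=> j; have := nnsumZ mV0 (nuE j).1; rewrite numu => -[_ <-].
by apply: eq_esum => k _; rewrite mulrA.
Qed.

End PositiveRecurrence.

(** * The criterion *)

Lemma ergodic_hit_bounded (R : realType) (E : countType) (P : E -> E -> R)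
    (H : {fset E}) (M : R) :
  transition_matrix P -> irreducible P -> aperiodic P -> H != fset0 ->
  (forall n j, j \in H -> trunc_hit P H n j <= M) -> ergodic P.
Proof.
move=> Pt Pi Pa /fset0Pn[i iH] hM.
have [p [p1 pst]] := stationary_exists Pt iH hM.
by exists p; split => // j; exact: mpow_cvg.
Qed.

(** The bound is independent of [C], so it controls a whole sequence of solutions at once. *)
Lemma ergodic_solution_le (R : realType) (E : countType) (P : E -> E -> R)
    (H : {fset E}) (p : E -> R) (y : E -> R) (C : R) :
  transition_matrix P -> irreducible P -> prob_distribution p ->
  stationary P p -> (forall i, y i <= C) -> solves_inequality P H y ->
  forall i, i \in H -> y i <= (p i)^-1.
Proof.
move=> Pt Pi p1 pst yC ysol i iH; have p0 := stationary_gt0 Pt Pi p1 pst i.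
have C0 : 0 <= `|C| by [].
have yC' j : y j <= `|C| by apply: le_trans (yC j) (ler_norm C).
have hp n : trunc_hit P H n i <= (p i)^-1.
  by rewrite -[X in _ <= X]mulr1 ler_pdivlMl//; exact: stationary_trunc_hit.
apply/ler_addgt0Pr => e e0.
have q0 : 0 <= `|C| * (p i)^-1 / e by rewrite !mulr_ge0// invr_ge0 ltW.
(* [N] exceeds [|C| / (p i * e)]; by [survival_markov] the term [|C| * survival N i] is then below
   [e]. *)
have := archi_boundP q0; set N := Num.bound _; rewrite ltr_pdivrMr// => NC.
apply: le_trans (solution_le Pt C0 yC' ysol N i) _; rewrite lerD//.
have N0 : 0 < N%:R :> R.
  rewrite -(pmulr_lgt0 _ e0); apply: le_lt_trans NC.
  by rewrite mulr_ge0// invr_ge0 ltW.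
rewrite -(ler_pM2l N0); apply: ltW; apply: le_lt_trans NC.
by rewrite mulrCA ler_wpM2l// (le_trans (survival_markov H Pt N i)).
Qed.

(** * Maxima over [H] and the two forms of the unboundedness condition *)

Section MaxOn.
Context {R : realType} {E : countType}.
Local Open Scope ereal_scope.

Lemma max_on_le (H : {fset E}) (y : E -> R) (x : \bar R) :
  (forall i, i \in H -> (y i)%:E <= x) -> max_on H y <= x.
Proof.
move=> yx; rewrite /max_on big_seq; elim/big_ind: _ => //; first exact: leNye.
by move=> u v ux vx; rewrite ge_max ux vx.
Qed.

Lemma le_max_on (H : {fset E}) (y : E -> R) i : i \in H -> (y i)%:E <= max_on H y.
Proof. by move=> iH; rewrite /max_on (big_rem i)//= le_max lexx. Qed.

Lemma max_on_lty (H : {fset E}) (y : E -> R) : max_on H y < +oo.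
Proof.
rewrite /max_on; elim/big_ind: _ => //; last by move=> i _; rewrite ltry.
by move=> u v uoo voo; rewrite gt_max uoo voo.
Qed.

End MaxOn.

(** Every term is below [+oo], so an infinite supremum stays infinite when finitely many terms are
    discarded; [esups u 1] is the supremum over indices from 1 on. *)
Lemma limn_esup_eqy (R : realType) (u : nat -> \bar R) : (forall n, u n < +oo)%E ->
  (ereal_sup [set u n | n in [set n : nat | (1 <= n)%N]] = +oo <->
   limn_esup u = +oo)%E.
Proof.
move=> uoo; have -> : limn_esup u = ereal_inf (range (esups u)).
  by rewrite limn_esup_lim; apply/cvg_lim => //; exact: cvg_esups_inf.
change ((esups u 1%N = +oo <-> ereal_inf (range (esups u)) = +oo)%E); split.
  move=> u1; suff uS n : esups u n.+1 = +oo%E.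
    apply/eqP; rewrite -leye_eq; apply: le_ereal_inf_tmp => _ [n _ <-].
    by rewrite -(uS n); apply: nonincreasing_esups.
  elim: n => // n IH; apply/eqP; apply/negPn/negP => uSoo.
  suff : (esups u n.+1 < +oo)%E by rewrite IH ltxx.
  apply: (@le_lt_trans _ _ (maxe (u n.+1) (esups u n.+2))).
    apply: ge_ereal_sup => _ [k /= nk <-]; rewrite le_max.
    move: nk; rewrite leq_eqVlt => /orP[/eqP ->|nk]; first by rewrite lexx.
    by apply/orP; right; apply: ereal_sup_ubound; exists k.
  by rewrite gt_max uoo lt_neqAle leey andbT.
move=> infoo; apply/eqP; rewrite -leye_eq -infoo.
by apply: ereal_inf_lbound; exists 1%N.
Qed.

Local Open Scope ereal_scope.

Theorem mainTheorem5 (R : realType) (E : countType) (P : E -> E -> R)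
    (H : {fset E}) (P_transition : transition_matrix P)
    (P_irreducible : irreducible P) (P_aperiodic : aperiodic P)
    (H_neq0 : H != fset0%fset) :
  (~ ergodic P <->
    exists y : nat -> E -> R,
      (forall n : nat, (1 <= n)%N ->
        ereal_sup [set (y n i)%:E | i in [set: E]] < +oo /\
        solves_inequality P H (y n)) /\
      ereal_sup [set max_on H (y n) | n in [set n : nat | (1 <= n)%N]] = +oo) /\
  (forall y : nat -> E -> R,
    ereal_sup [set max_on H (y n) | n in [set n : nat | (1 <= n)%N]] = +oo <->
    limn_esup (fun n : nat => max_on H (y n)) = +oo).
Proof.
split; last by move=> y; apply: limn_esup_eqy => n; exact: max_on_lty.
split=> [nerg|[y [ysol ysup]] [p [p1 pst _]]].
  exists (trunc_hit P H); split=> [n _|].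
    split; last exact: trunc_hit_solves.
    apply: (@le_lt_trans _ _ n%:R%:E); last exact: ltry.
    apply: ge_ereal_sup => _ [i _ <-]; rewrite lee_fin.
    by case/andP: (trunc_hit_itv H P_transition n i).
  apply/eqP; apply/negPn/negP => supoo; apply: nerg.
  have [M supM] : exists M : R,
      ereal_sup [set max_on H (trunc_hit P H n) | n in [set n | (1 <= n)%N]] <= M%:E.
    case: ereal_sup supoo => [M|//|] _; first by exists M.
    by exists 0%R; exact: leNye.
  apply: (@ergodic_hit_bounded _ _ _ H M) => // n j jH.
  (* The supremum starts at index 1, so the bound at [n], possibly 0, goes through [n.+1]. *)
  apply: le_trans (trunc_hit_ndecr H P_transition n j) _.
  rewrite -lee_fin; apply: le_trans supM.
  apply: le_trans (le_max_on (trunc_hit P H n.+1) jH) _.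
  by apply: ereal_sup_ubound; exists n.+1.
suff : ereal_sup [set max_on H (y n) | n in [set n | (1 <= n)%N]] < +oo.
  by rewrite ysup ltxx.
apply: le_lt_trans (max_on_lty H (fun i => (p i)^-1)%R).
apply: ge_ereal_sup => _ [n /= n1 <-]; have [ysupn ysoln] := ysol n n1.
apply: max_on_le => i iH; apply: le_trans (le_max_on (fun i => (p i)^-1)%R iH).
have [C yC] : exists C : R, forall j, (y n j <= C)%R.
  have : forall j, (y n j)%:E <= ereal_sup [set (y n i)%:E | i in [set: E]].
    by move=> j; apply: ereal_sup_ubound; exists j.
  case: ereal_sup ysupn => [C _ yC|//|_ yC].
    by exists C => j; rewrite -lee_fin yC.
  by have := yC i.
rewrite lee_fin; exact: ergodic_solution_le yC ysoln i iH.
Qed.
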